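(* Let $p\in\mathbb{R}$ and $q>0$, and assume that the continuous function $\mathcal{H}$ is nonnegative and strictly increasing in $[0,+\infty)$. Consider the problem $$\min_{\gamma\ge 0}\ \mathcal{L}(\gamma)=-\frac12\frac{p^2\gamma}{1+q\gamma}+\frac12\log(1+q\gamma)+\mathcal{H}(\gamma)$$ and its KKT conditions $$\frac12\frac{q^2\gamma+(q-p^2)}{(1+q\gamma)^2}+\mathcal{H}'(\gamma)-\mu=0,\qquad \mu\ge0,\ \gamma\ge0,\qquad \mu\gamma=0 .$$ Then any KKT point $\gamma^\star$ (i.e. any $\gamma^\star$ for which some multiplier $\mu$ makes $(\gamma^\star,\mu)$ satisfy these conditions) satisfies either $\gamma^\star=0$ or $\gamma^\star\in\left(0,\frac{p^2-q}{q^2}\right)$.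
   Context: $\mathcal{H}$ is a function on $[0,+\infty)$ with derivative $\mathcal{H}'$ on $(0,+\infty)$; at $\gamma=0$ the term $\mathcal{H}'(\gamma)$ in the KKT conditions is read as $\mathcal{H}'(0^+)=\lim_{\gamma\to0^+}\mathcal{H}'(\gamma)$. The interval $\left(0,\frac{p^2-q}{q^2}\right)$ is empty when $p^2\le q$.
   Formalization: The formal theorem additionally assumes H'(γ) > 0 for every γ > 0; strict increase alone gives only H' ≥ 0, and the claim then fails, e.g. for H(γ) = (γ−1)³+1, q = 1, p = √2, where γ = 1 is a KKT point equal to the excluded right endpoint. *)

(* Defs.v *)
From HB Require Import structures.
From mathcomp Require Import all_boot all_order all_algebra.
From mathcomp Require Import all_classical all_reals all_analysis.
From mathcomp Require Import ring lra.
Set Implicit Arguments.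
Unset Strict Implicit.
Unset Printing Implicit Defensive.
Import Order.TTheory GRing.Theory Num.Theory.
Import numFieldNormedType.Exports.
Local Open Scope classical_set_scope.
Local Open Scope ring_scope.

(* A function on [0, +oo[ is represented by a total [H : R -> R] whose values
   at negative arguments are never used. *)

Definition objective (R : realType) (p q : R) (H : R -> R) (g : R) : R :=
  - (2^-1 * (p ^+ 2 * g / (1 + q * g))) + 2^-1 * ln (1 + q * g) + H g.

Definition smooth_slope (R : realType) (p q g : R) : R :=
  2^-1 * ((q ^+ 2 * g + (q - p ^+ 2)) / (1 + q * g) ^+ 2).

(* [d] is the value of H' at [g], with H'(0) read as the (finite) right limit
   H'(0+). *)
Definition penalty_slope (R : realType) (H : R -> R) (g d : R) : Prop :=
  (0 < g /\ d = derive1 H g) \/ (g = 0 /\ derive1 H x @[x --> 0^'+] --> d).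

Definition KKT (R : realType) (p q : R) (H : R -> R) (g mu : R) : Prop :=
  (exists2 d, penalty_slope H g d & smooth_slope p q g + d - mu = 0) /\
  0 <= mu /\ 0 <= g /\ mu * g = 0.

Definition KKT_point (R : realType) (p q : R) (H : R -> R) (g : R) : Prop :=
  exists mu, KKT p q H g mu.

(* Strict increase of H only gives H' >= 0, and if H' vanishes at
   (p ^ 2 - q) / q ^ 2 then that excluded endpoint is itself a KKT point: take
   H(g) = (g - 1) ^ 3 + 1, q = 1, p ^ 2 = 2, g = 1.  The theorem therefore also
   assumes H' > 0 on ]0, +oo[. *)

(* Stationarity in [KKT] is stated with the explicit formula; this is the link
   with [objective]. *)
Lemma is_derive_objective (R : realType) (p q : R) (H : R -> R) (g : R) :
  0 < q -> 0 < g -> derivable H g 1 ->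
  is_derive g 1 (objective p q H) (smooth_slope p q g + derive1 H g).
Proof.
move=> q0 g0 dH.
have u0 : 0 < 1 + q * g by rewrite ltr_pwDl// mulr_ge0// ltW.
have un : 1 + q * g != 0 by rewrite gt_eqF.
have du : is_derive g 1 (fun x : R => 1 + q * x) q.
  have -> : (fun x : R => 1 + q * x) = cst 1 + q \*: id by apply/funext.
  by apply: is_derive_eq; rewrite add0r scaler1.
have dHg : is_derive g 1 H (derive1 H g).
  by rewrite derive1E; exact: derivableP.
have dl : is_derive g 1 (fun x : R => ln (1 + q * x)) (q / (1 + q * g)).
  have dln := is_derive1_ln u0.
  by apply: (is_derive_eq (@is_derive1_comp R (@ln R) _ g _ q dln du)); rewrite mulrC.
have dv := is_deriveV (f := fun x : R => 1 + q * x) un du.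
have -> : objective p q H =
  (- (2^-1 * p ^+ 2)) \*: (id * (fun x : R => (1 + q * x)^-1))
  + 2^-1 \*: (fun x : R => ln (1 + q * x)) + H.
  apply/funext => x; rewrite /objective.
  change (- (2^-1 * (p ^+ 2 * x / (1 + q * x))) + 2^-1 * ln (1 + q * x) + H x =
    - (2^-1 * p ^+ 2) * (x / (1 + q * x)) + 2^-1 * ln (1 + q * x) + H x).
  by rewrite mulNr !mulrA.
apply: is_derive_eq; rewrite /smooth_slope /GRing.scale /=.
by field.
Qed.

(* Main.v *)
Require Import Defs.
From HB Require Import structures.
From mathcomp Require Import all_boot all_order all_algebra.
From mathcomp Require Import all_classical all_reals all_analysis.
Import Order.TTheory GRing.Theory Num.Theory.
Import numFieldNormedType.Exports.
Local Open Scope classical_set_scope.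
Local Open Scope ring_scope.

(** If [g > 0], complementarity forces [mu = 0], so stationarity equates the slope of the smooth
    part with [- H'(g)], which is negative. That slope has the sign of its numerator
    [q^2 g + (q - p^2)], and negativity of the numerator is the upper bound on [g]. *)

Theorem corollary3p2 (R : realType) (p q : R) (H : R -> R)
  (q_gt0 : 0 < q)
  (H_cont : {within `[0, +oo[, continuous H})
  (H_ge0 : forall x : R, 0 <= x -> 0 <= H x)
  (H_incr : forall x y : R, 0 <= x -> x < y -> H x < H y)
  (H_derivable : forall x : R, 0 < x -> derivable H x 1)
  (H_slope_gt0 : forall x : R, 0 < x -> 0 < derive1 H x)
  (g : R) (g_KKT : KKT_point p q H g) :
  g = 0 \/ g \in `]0, (p ^+ 2 - q) / q ^+ 2[.
Proof.
case: g_KKT => mu [[d slope_d stat] [mu_ge0 [g_ge0 compl]]].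
case: slope_d => [[g_gt0 dE]|[-> _]]; last by left.
right.
have mu0 : mu = 0.
  by move/eqP: compl; rewrite mulf_eq0 (gt_eqF g_gt0) orbF => /eqP.
have d_gt0 : 0 < d by rewrite dE H_slope_gt0.
have den_gt0 : 0 < (1 + q * g) ^+ 2.
  by rewrite exprn_gt0// ltr_pwDl// mulr_ge0// ltW.
(* Strictness, inherited from [d_gt0], is what excludes the right endpoint. *)
have smooth_lt0 : smooth_slope p q g < 0.
  by move: stat; rewrite mu0 subr0 => /eqP; rewrite addr_eq0 => /eqP ->; rewrite oppr_lt0.
(* The positive factors [1/2] and [(1 + q g)^-2] are cancelled, leaving the numerator. *)
move: smooth_lt0; rewrite /smooth_slope pmulr_rlt0 ?invr_gt0// pmulr_llt0 ?invr_gt0// => num_lt0.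
rewrite in_itv /= g_gt0 /= ltr_pdivlMr ?exprn_gt0//.
by rewrite mulrC -subr_lt0 opprB.
Qed.
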